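(* Let $A\in\mathbb M_m$ be a Perron-like matrix with principal eigenvalue $s=s(A)$, let $\delta>0$ be such that $\mathrm{Re}\,\mu\le s-2\delta$ for all $\mu\in\sigma(A)\setminus\{s\}$, and let $\{v_i\}_{i\in J}$ be a basis of $\mathbb R^m$. Put $x_i(t)=e^{tA}v_i$, $X(t)=[x_i(t)]_{i\in J}$, $y_i=\Pi_1v_i$, $Y=[y_i]_{i\in J}$ and $\xi_i=y_i/\|Y\|$. Suppose $s$ is semisimple. Then there exist $B_1,B_2>0$ such that, for every $i\in J$, $$\left\|\frac{x_i(t)}{\|X(t)\|}-\xi_i\right\|\le B_1e^{-\delta t},\qquad t\ge1,$$ and $$\left|\frac{1}{\|X(t)\|^2}\sum_{i\in J}\langle Ax_i(t),x_i(t)\rangle-s\right|\le B_2e^{-\delta t},\qquad t\ge1.$$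
   Context: $J=\{1,\dots,m\}$. $\mathbb M_m$ is the space of real $m\times m$ matrices; $[\alpha_i]_{i\in J}$ denotes the matrix with columns $\alpha_i$. $\mathbb R^m$ carries the Euclidean inner product and norm; on $\mathbb M_m$, $\|[\alpha_i]_{i\in J}\|=(\sum_{i\in J}\|\alpha_i\|^2)^{1/2}$. $\sigma(A)$ is the set of (complex) eigenvalues of $A$, $s(A)=\max\{\mathrm{Re}\,\mu:\mu\in\sigma(A)\}$. $A$ is Perron-like if $s:=s(A)\in\sigma(A)$ and $\mathrm{Re}\,\mu<s$ for all $\mu\in\sigma(A)\setminus\{s\}$; $s$ is then called the principal eigenvalue. $\mathrm{E}_s(A)=\ker(A-sI)$; $\mathrm{GE}_s(A)=\{\xi\in\mathbb R^m:(A-sI)^k\xi=0\text{ for some }k\ge1\}$; $s$ is semisimple if $\mathrm{GE}_s(A)=\mathrm{E}_s(A)$. For any $\mu\in\sigma(A)$, $\mathrm{GE}_\mu(A)\subset\mathbb R^m$ is the set of all real and imaginary parts of vectors $u\in\mathbb C^m$ with $(A-\mu I)^ku=0$ for some $k\ge1$. Then $\mathbb R^m=E_1\oplus E_2$ with $E_1=\mathrm{GE}_s(A)$, $E_2=\sum_{\mu\in\sigma(A)\setminus\{s\}}\mathrm{GE}_\mu(A)$, and $\Pi_1$ is the projection onto $E_1$ along $E_2$. *)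

(* Defs.v *)
From HB Require Import structures.
From mathcomp Require Import all_boot all_order all_algebra.
From mathcomp Require Import all_classical all_reals all_analysis.
From mathcomp Require Import complex.

Set Implicit Arguments.
Unset Strict Implicit.
Unset Printing Implicit Defensive.

Import Order.TTheory GRing.Theory Num.Theory.
Import numFieldNormedType.Exports.

Local Open Scope classical_set_scope.
Local Open Scope ring_scope.
Local Open Scope complex_scope.

(* The norm that the library puts on matrices is the sup norm; the Euclidean
   structures are therefore defined here. *)
Definition inner (R : realType) (m : nat) (x y : 'cV[R]_m) : R :=
  \sum_(k < m) x k 0 * y k 0.

Definition vnorm (R : realType) (m : nat) (x : 'cV[R]_m) : R :=
  Num.sqrt (inner x x).

Definition mnorm (R : realType) (m : nat) (M : 'M[R]_m) : R :=
  Num.sqrt (\sum_(i < m) vnorm (col i M) ^+ 2).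

Definition mx_of_cols (R : realType) (m : nat) (a : 'I_m -> 'cV[R]_m) :
  'M[R]_m := \matrix_(k, i) a i k 0.

Definition is_basis (R : realType) (m : nat) (v : 'I_m -> 'cV[R]_m) : bool :=
  basis_of fullv [seq v i | i <- enum 'I_m].

(* Limit of the exponential series in the topology of 'M[R]_m. *)
Definition expm (R : realType) (m : nat) (A : 'M[R]_m) : 'M[R]_m :=
  lim (series (fun k : nat => (k`!%:R)^-1 *: A ^+ k) @ \oo).

Definition mxC (R : realType) (m : nat) (A : 'M[R]_m) : 'M[R[i]]_m :=
  map_mx (real_complex R) A.

(* [eigenvalue] refers to row eigenvectors; a square matrix has the same
   eigenvalues on rows and on columns. *)
Definition spectrum (R : realType) (m : nat) (A : 'M[R]_m) : set R[i] :=
  [set mu | eigenvalue (mxC A) mu].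

(* The spectrum is finite, so for m > 0 this supremum is a maximum. *)
Definition spectral_abscissa (R : realType) (m : nat) (A : 'M[R]_m) : R :=
  sup [set complex.Re mu | mu in spectrum A].

Definition perron_like (R : realType) (m : nat) (A : 'M[R]_m) : Prop :=
  let s := spectral_abscissa A in
  spectrum A s%:C /\
  forall mu : R[i], (spectrum A `\ s%:C) mu -> complex.Re mu < s.

Definition E_ (R : realType) (m : nat) (A : 'M[R]_m) (s : R) :
  set 'cV[R]_m := [set x | (A - s%:M) *m x = 0].

Definition GE_ (R : realType) (m : nat) (A : 'M[R]_m) (s : R) :
  set 'cV[R]_m :=
  [set x | exists2 k : nat, (1 <= k)%N & (A - s%:M) ^+ k *m x = 0].

Definition semisimple (R : realType) (m : nat) (A : 'M[R]_m) (s : R) : Prop :=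
  GE_ A s = E_ A s.

Definition GEC (R : realType) (m : nat) (A : 'M[R]_m) (mu : R[i]) :
  set 'cV[R[i]]_m :=
  [set u | exists2 k : nat, (1 <= k)%N & (mxC A - mu%:M) ^+ k *m u = 0].

Definition GE_re_im (R : realType) (m : nat) (A : 'M[R]_m) (mu : R[i]) :
  set 'cV[R]_m :=
  [set x | exists2 u, GEC A mu u &
     x = map_mx (@complex.Re R) u \/ x = map_mx (@complex.Im R) u].

Definition E1 (R : realType) (m : nat) (A : 'M[R]_m) : set 'cV[R]_m :=
  GE_ A (spectral_abscissa A).

Definition E2 (R : realType) (m : nat) (A : 'M[R]_m) : set 'cV[R]_m :=
  let S := spectrum A `\ (spectral_abscissa A)%:C in
  [set x | exists2 w : R[i] -> 'cV[R]_m,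
     forall mu, S mu -> GE_re_im A mu (w mu) & x = \sum_(mu \in S) w mu].

(* Projection onto U along W; it is only meaningful when the space is the
   direct sum of U and W. *)
Definition proj_along (R : realType) (m : nat) (U W : set 'cV[R]_m)
  (x : 'cV[R]_m) : 'cV[R]_m := xget 0 [set y | U y /\ W (x - y)].

Definition Pi1 (R : realType) (m : nat) (A : 'M[R]_m) (x : 'cV[R]_m) :
  'cV[R]_m := proj_along (E1 A) (E2 A) x.

(* Main.v *)
(* Each v_i splits as y_i + z_i with y_i in E1 and z_i in E2. Semisimplicity
   gives e^{tA} y_i = e^{st} y_i. If (A - mu)^k u = 0, the function
   |e^{tA} Re u|^2 + |e^{tA} Im u|^2 is O(e^{(2 Re mu + eps) t}) for every
   eps > 0, by induction on k: its derivative is 2 Re mu times itself plus a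
   cross term with (A - mu) u, absorbed by AM-GM. Hence e^{tA} z_i is
   O(e^{(s - delta) t}), and e^{-st} X(t) = Y + O(e^{-delta t}). Both normalised
   quantities are invariant under scaling X(t), and their distance to the values
   at Y is at most a constant times |e^{-st} X(t) - Y| / |Y|. Finally Y <> 0:
   otherwise every vector would be O(e^{(s - delta) t}) under the flow,
   contradicting the existence of an eigenvector for s. *)
Require Import Defs.
From HB Require Import structures.
From mathcomp Require Import all_boot all_order all_algebra.
From mathcomp Require Import all_classical all_reals all_analysis.
From mathcomp Require Import complex ring lra.

Set Implicit Arguments.
Unset Strict Implicit.
Unset Printing Implicit Defensive.

Import Order.TTheory GRing.Theory Num.Theory.
Import numFieldNormedType.Exports.

Local Open Scope classical_set_scope.
Local Open Scope ring_scope.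
Local Open Scope complex_scope.

(** * Euclidean norm of finite families *)

Section L2.
Variables (R : realType) (I : finType).
Implicit Types f g : I -> R.

Definition l2norm f : R := Num.sqrt (\sum_i f i ^+ 2).

Lemma l2norm_ge0 f : 0 <= l2norm f.
Proof. exact: sqrtr_ge0. Qed.

Lemma sqr_l2norm f : l2norm f ^+ 2 = \sum_i f i ^+ 2.
Proof. by rewrite sqr_sqrtr// sumr_ge0// => i _; exact: sqr_ge0. Qed.

Lemma eq_l2norm f g : f =1 g -> l2norm f = l2norm g.
Proof. by move=> fg; congr Num.sqrt; apply: eq_bigr => i _; rewrite fg. Qed.

Lemma l2normZ c f : l2norm (fun i => c * f i) = `|c| * l2norm f.
Proof.
rewrite /l2norm; under eq_bigr do rewrite exprMn.
by rewrite -mulr_sumr sqrtrM ?sqr_ge0// sqrtr_sqr.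
Qed.

Lemma l2normN f : l2norm (fun i => - f i) = l2norm f.
Proof. by congr Num.sqrt; apply: eq_bigr => i _; rewrite sqrrN. Qed.

Lemma l2norm_coord f i : `|f i| <= l2norm f.
Proof.
rewrite -ler_sqr ?nnegrE ?l2norm_ge0// sqr_l2norm real_normK ?num_real//.
by rewrite (bigD1 i)//= lerDl sumr_ge0// => j _; exact: sqr_ge0.
Qed.

Lemma l2norm_eq0 f : l2norm f = 0 -> forall i, f i = 0.
Proof.
by move=> f0 i; apply/eqP; rewrite -normr_le0 -f0; exact: l2norm_coord.
Qed.

(** The crude factor [#|I|], in place of its square root, comes from [#|I| <= #|I| ^ 2] and keeps
    the constants free of roots. *)
Lemma l2norm_le_coord f c : 0 <= c -> (forall i, `|f i| <= c) ->
  l2norm f <= #|I|%:R * c.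
Proof.
move=> c0 fc; rewrite -ler_sqr ?nnegrE ?l2norm_ge0 ?mulr_ge0//.
rewrite sqr_l2norm (@le_trans _ _ (\sum_(i : I) c ^+ 2))//.
  by apply: ler_sum => i _; rewrite -real_normK ?num_real// lerXn2r ?nnegrE.
rewrite sumr_const -[X in X <= _]mulr_natl exprMn; apply: ler_wpM2r.
  exact: sqr_ge0.
by rewrite -natrX ler_nat; case: #|I| => // n; exact: leq_pmulr.
Qed.

(** Lagrange's identity: the squares of the two sides differ by half the sum of all
    [(f i * g j - f j * g i) ^+ 2]. *)
Lemma cauchy_schwarz f g : `|\sum_i f i * g i| <= l2norm f * l2norm g.
Proof.
rewrite -ler_sqr ?nnegrE ?mulr_ge0 ?l2norm_ge0// real_normK ?num_real//.
rewrite exprMn !sqr_l2norm -subr_ge0.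
suff -> : (\sum_i f i ^+ 2) * (\sum_i g i ^+ 2) - (\sum_i f i * g i) ^+ 2 =
    2^-1 * \sum_i \sum_j (f i * g j - f j * g i) ^+ 2.
  rewrite mulr_ge0 ?invr_ge0// sumr_ge0// => i _.
  by rewrite sumr_ge0// => j _; exact: sqr_ge0.
have -> : \sum_i \sum_j (f i * g j - f j * g i) ^+ 2 =
  \sum_i \sum_j f i ^+ 2 * g j ^+ 2 + \sum_i \sum_j f j ^+ 2 * g i ^+ 2
  - 2 * \sum_i \sum_j (f i * g i) * (f j * g j).
  rewrite mulr_sumr -big_split -sumrB; apply: eq_bigr => i _ /=.
  rewrite mulr_sumr -big_split -sumrB; apply: eq_bigr => j _ /=.
  by ring.
by rewrite [X in _ + X - _]exchange_big expr2 !big_distrlr/=; field.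
Qed.

Lemma l2normD f g : l2norm (fun i => f i + g i) <= l2norm f + l2norm g.
Proof.
rewrite -ler_sqr ?nnegrE ?addr_ge0 ?l2norm_ge0//.
have -> : l2norm (fun i => f i + g i) ^+ 2 =
    l2norm f ^+ 2 + 2 * (\sum_i f i * g i) + l2norm g ^+ 2.
  rewrite !sqr_l2norm mulr_sumr -!big_split; apply: eq_bigr => i _ /=.
  by rewrite sqrrD; ring.
have := le_trans (ler_norm _) (cauchy_schwarz f g).
by rewrite sqrrD; lra.
Qed.

Lemma l2normB_le f g : `|l2norm f - l2norm g| <= l2norm (fun i => f i - g i).
Proof.
have fg := l2normD (fun i => f i - g i) g.
have gf := l2normD (fun i => - (f i - g i)) f.
rewrite l2normN in gf.
rewrite (@eq_l2norm _ f) in fg; last by move=> i; rewrite subrK.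
rewrite (@eq_l2norm _ g) in gf; last by move=> i; rewrite opprB subrK.
by rewrite ler_norml; lra.
Qed.

(* Also valid when [f] or [g] vanishes, because [0^-1 = 0]. *)
Lemma l2norm_normalize f g :
  l2norm g * l2norm (fun i => (l2norm f)^-1 * f i - (l2norm g)^-1 * g i) <=
    2 * l2norm (fun i => f i - g i).
Proof.
have [->|g0] := eqVneq (l2norm g) 0.
  by rewrite mul0r mulr_ge0 ?l2norm_ge0.
rewrite -{1}(ger0_norm (l2norm_ge0 g)) -l2normZ.
(* The second summand has norm at most [|l2norm g - l2norm f|], hence at most the norm of [f - g];
   this is the origin of the factor 2. *)
have -> : l2norm (fun i => l2norm g *
      ((l2norm f)^-1 * f i - (l2norm g)^-1 * g i)) =
    l2norm (fun i => (f i - g i) + (l2norm g - l2norm f) / l2norm f * f i).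
  apply: eq_l2norm => i.
  have [f0|f0] := eqVneq (l2norm f) 0.
    by rewrite f0 (l2norm_eq0 f0) invr0; field.
  by field; rewrite f0.
rewrite (le_trans (l2normD _ _))// [leRHS]mulr_natl mulr2n.
rewrite lerD2l l2normZ normrM normfV (ger0_norm (l2norm_ge0 _)).
rewrite (@le_trans _ _ `|l2norm g - l2norm f|)//.
  have [->|f0] := eqVneq (l2norm f) 0; first by rewrite mulr0.
  by rewrite divfK.
by rewrite distrC l2normB_le.
Qed.

End L2.

(** * Matrix exponential *)

Section MatrixExponential.
Variables (R : realType) (m : nat).
Implicit Types (A M : 'M[R]_m) (v : 'cV[R]_m).

Lemma cvg_mx_entries (F : set_system 'M[R]_m) (FF : Filter F) M :
  (forall i j, (fun N : 'M[R]_m => N i j) @ F --> M i j) -> F --> M.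
Proof.
move=> FM; apply/cvg_mx_entourageP => E entE.
apply: filter_forall => i; apply: filter_forall => j.
have /(_ _ _ entE) FE := (cvg_entourageP _ _).1 (FM i j).
by apply: (@filterS _ F _ _ _ _ FE) => N /=; rewrite inE.
Qed.

Lemma mxpow_entry_le A : exists2 c : R, 0 <= c &
  forall n i j, `|(A ^+ n) i j| <= c ^+ n.
Proof.
(* The sum over all entries dominates every absolute row sum, which is the factor gained at each
   induction step. *)
exists (\sum_i \sum_j `|A i j|).
  by rewrite sumr_ge0// => i _; rewrite sumr_ge0.
set c := \sum_i _; elim=> [|n IH] i j.
  by rewrite !expr0 mxE; case: eqP; rewrite ?normr1 ?normr0.
rewrite !exprS [X in `|X|]mxE (le_trans (ler_norm_sum _ _ _))//.
rewrite (@le_trans _ _ (\sum_k `|A i k| * c ^+ n))//.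
  by apply: ler_sum => k _; rewrite normrM ler_wpM2l.
rewrite -mulr_suml ler_wpM2r//.
  by rewrite exprn_ge0// sumr_ge0// => k _; rewrite sumr_ge0.
by rewrite /c [leRHS](bigD1 i)//= lerDl sumr_ge0// => k _; rewrite sumr_ge0.
Qed.

(** With [v] fixed, each coordinate of [e^{tA} v] is a scalar power series in [t], so convergence
    and termwise differentiation are scalar questions. *)
Definition expm_coeff A v (k : 'I_m) (n : nat) : R :=
  (n`!%:R)^-1 * (A ^+ n *m v) k 0.

(** Comparison with the exponential series at [c * |x|], scaled by the l1 norm [b] of [v]. *)
Lemma cvg_pseries_expm A v k (x : R) : cvgn (pseries (expm_coeff A v k) x).
Proof.
have [c c0 Ac] := mxpow_entry_le A.
pose b : R := \sum_j `|v j 0|.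
have b0 : 0 <= b by exact: sumr_ge0.
apply: normed_cvg.
apply: (@series_le_cvg _ _ (b *: exp_coeff (c * `|x|))) => [n|n|n|].
- exact: normr_ge0.
- by rewrite /GRing.scale/= mulr_ge0// exp_coeff_ge0// mulr_ge0.
- rewrite /expm_coeff /= 2!normrM normfV normr_nat normrX.
  have -> : (b *: exp_coeff (c * `|x|)) n =
      n`!%:R^-1 * (c ^+ n * b) * `|x| ^+ n.
    transitivity (b * ((c * `|x|) ^+ n / n`!%:R)) => //.
    by rewrite exprMn; ring.
  rewrite ler_wpM2r ?exprn_ge0// ler_wpM2l ?invr_ge0// mxE.
  rewrite (le_trans (ler_norm_sum _ _ _))// mulr_sumr ler_sum// => j _.
  by rewrite normrM ler_wpM2r.
- by apply: is_cvg_seriesZ; exact: is_cvg_series_exp_coeff.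
Qed.

Lemma mulmx_delta_entry M i j : (M *m delta_mx j (0 : 'I_1)) i 0 = M i j.
Proof. by rewrite -colE mxE. Qed.

Lemma exprZmx (t : R) A n : (t *: A) ^+ n = t ^+ n *: A ^+ n.
Proof.
elim: n => [|n IH]; first by rewrite !expr0 scale1r.
by rewrite !exprS IH -[LHS]/(_ *m _) -scalemxAl -scalemxAr scalerA.
Qed.

Lemma expm_entry A t i j :
  expm (t *: A) i j = limn (pseries (expm_coeff A (delta_mx j 0) i) t).
Proof.
pose L := \matrix_(i, j) limn (pseries (expm_coeff A (delta_mx j 0) i) t).
pose u : nat -> 'M[R]_m :=
  series (fun k => (k`!%:R : R)^-1 *: (t *: A) ^+ k).
suff : u @ \oo --> L.
  by move/cvg_lim => LE; rewrite /expm -/u LE ?mxE//; exact: norm_hausdorff.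
apply: cvg_mx_entries => {}i {}j; rewrite mxE.
have uE : (fun N : 'M[R]_m => N i j) \o u =
    pseries (expm_coeff A (delta_mx j 0) i) t.
  apply/funext => n /=.
  rewrite /u /pseries /series/= summxE; apply: eq_bigr => k _.
  by rewrite /expm_coeff mulmx_delta_entry mxE exprZmx mxE; ring.
by rewrite -fmap_comp uE; exact: cvg_pseries_expm.
Qed.

Lemma expm_mul A v t k :
  (expm (t *: A) *m v) k 0 = limn (pseries (expm_coeff A v k) t).
Proof.
have -> : pseries (expm_coeff A v k) t =
    (fun n => \sum_j v j 0 *: pseries (expm_coeff A (delta_mx j 0) k) t n).
  apply/funext => n; rewrite /pseries /series/=.
  under [RHS]eq_bigr do rewrite scaler_sumr.
  rewrite exchange_big; apply: eq_bigr => l _.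
  rewrite /expm_coeff [X in _ * X * _]mxE mulr_sumr mulr_suml.
  apply: eq_bigr => j _ /=.
  by rewrite mulmx_delta_entry /GRing.scale/=; ring.
apply/esym/cvg_lim => //; rewrite mxE.
apply: cvg_big => [|j _]; first exact: add_continuous.
rewrite expm_entry mulrC; apply: cvgZl_tmp.
exact: cvg_pseries_expm.
Qed.

(** Since [(n+1) / (n+1)! = 1 / n!] and [A^(n+1) v = A^n (A v)], the family of coefficients is
    closed under formal differentiation. *)
Lemma pseries_diffs_expm_coeff A v k :
  pseries_diffs (expm_coeff A v k) = expm_coeff A (A *m v) k.
Proof.
apply/funext => n; rewrite /pseries_diffs /expm_coeff factS natrM.
rewrite exprSr -mulmxA mulrA; congr (_ * _).
by rewrite invfM mulVKf.
Qed.

Lemma is_derive_expm A v k t :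
  is_derive t (1 : R) (fun t => (expm (t *: A) *m v) k 0)
    ((expm (t *: A) *m (A *m v)) k 0).
Proof.
rewrite expm_mul -pseries_diffs_expm_coeff.
have -> : (fun t => (expm (t *: A) *m v) k 0) =
    (fun t => limn (pseries (expm_coeff A v k) t)).
  by apply/funext => z; exact: expm_mul.
(* Termwise differentiation at [t] asks for convergence at a point of larger modulus; [|t| + 1] is
   one. *)
apply: (@pseries_snd_diffs _ _ (`|t| + 1)).
- exact: cvg_pseries_expm.
- rewrite pseries_diffs_expm_coeff; exact: cvg_pseries_expm.
- rewrite !pseries_diffs_expm_coeff; exact: cvg_pseries_expm.
- by rewrite [ltRHS]ger0_norm ?addr_ge0// ltrDl.
Qed.

Lemma expm_eigen A v (s t : R) :
  A *m v = s *: v -> expm (t *: A) *m v = expR (s * t) *: v.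
Proof.
move=> Av; apply/colP => k; rewrite expm_mul [RHS]mxE.
have Anv n : A ^+ n *m v = s ^+ n *: v.
  elim: n => [|n IH]; first by rewrite !expr0 mul1mx scale1r.
  by rewrite exprSr -mulmxA Av -scalemxAr IH scalerA exprS.
have -> : pseries (expm_coeff A v k) t =
    (fun n => v k 0 *: series (exp_coeff (s * t)) n).
  apply/funext => n; rewrite /pseries /series/= [RHS]mulr_sumr.
  apply: eq_bigr => l _.
  by rewrite /expm_coeff Anv mxE /exp_coeff/= exprMn; ring.
rewrite [RHS]mulrC /expR; apply/cvg_lim => //; apply: cvgZl_tmp.
exact: is_cvg_series_exp_coeff.
Qed.

End MatrixExponential.

(** * Growth along the flow *)

Section Growth.
Variables (R : realType) (m : nat) (A : 'M[R]_m).
Implicit Types (a b c d : 'cV[R]_m).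

Lemma le_at0_of_derive_le0 (f f' : R -> R) :
  (forall t, is_derive t (1 : R) f (f' t)) ->
  (forall t, 0 < t -> f' t <= 0) -> forall t, 0 <= t -> f t <= f 0.
Proof.
move=> df f'0 t t0; apply: (@ler0_derive1_nincry _ f 0) => //.
- move=> x; rewrite in_itv/= andbT => x0.
  by have [_ fx] := df x; rewrite derive1E fx; exact: f'0.
- apply: continuous_subspaceT => x; have [dfx _] := df x.
  by apply/differentiable_continuous/derivable1_diffP.
Qed.

Lemma is_derive_expRM (k t : R) :
  is_derive t (1 : R) (fun t => expR (k * t)) (k * expR (k * t)).
Proof.
have dk : is_derive t (1 : R) (fun t : R => k *: t) (k *: 1).
  exact: is_deriveZ.
have := is_derive1_comp (is_derive_expR (k * t)) dk.
by rewrite /GRing.scale/= mulr1 mulrC.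
Qed.

(** This is the squared Hermitian norm of [e^{tA} (a + i b)], written with real vectors only. *)
Definition flow_energy a b (t : R) : R :=
  \sum_k ((expm (t *: A) *m a) k 0 ^+ 2 + (expm (t *: A) *m b) k 0 ^+ 2).

Lemma is_derive_flow_energy a b t :
  is_derive t (1 : R) (flow_energy a b)
   (\sum_k (2 * ((expm (t *: A) *m a) k 0 * (expm (t *: A) *m (A *m a)) k 0 +
             (expm (t *: A) *m b) k 0 * (expm (t *: A) *m (A *m b)) k 0))).
Proof.
have -> : flow_energy a b = \sum_k ((fun t => (expm (t *: A) *m a) k 0) ^+ 2 +
   (fun t => (expm (t *: A) *m b) k 0) ^+ 2).
  by apply/funext => z; rewrite fct_sumE.
apply: is_derive_sum => k.
have da := @is_derive_expm _ _ A a k t.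
have db := @is_derive_expm _ _ A b k t.
apply: is_derive_eq.
rewrite /GRing.scale/=. ring.
Qed.

(** The hypotheses on [A *m a] and [A *m b] are the real and imaginary parts of [A u = mu u + w],
    with [u = a + i b], [w = c + i d], [mu = al + i be]. The [be] terms cancel in the derivative of
    the energy. The rate is the same for [w] and [u], so the step can be iterated without loss. *)
Lemma flow_energy_growth_step a b c d (al be eps C : R) :
  0 < eps -> A *m a = al *: a - be *: b + c -> A *m b = be *: a + al *: b + d ->
  (forall t, 0 <= t -> flow_energy c d t <= C * expR ((2 * al + eps) * t)) ->
  exists C' : R, forall t, 0 <= t ->
    flow_energy a b t <= C' * expR ((2 * al + eps) * t).
Proof.
move=> e0 Aa Ab cdC.
(* Half of [eps] pays for AM-GM; the other half absorbs the forcing term. [K] is the forcing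
   constant [2 / eps * C] divided by the remaining rate [eps / 2]. *)
pose k := 2 * al + eps / 2; pose K := 4 * C / eps ^+ 2.
have e_neq0 : eps != 0 by rewrite gt_eqF.
pose dphi t := \sum_k (2 * (
  (expm (t *: A) *m a) k 0 * (expm (t *: A) *m (A *m a)) k 0 +
  (expm (t *: A) *m b) k 0 * (expm (t *: A) *m (A *m b)) k 0)).
have dphi_le t : 0 < t -> dphi t <=
    k * flow_energy a b t + 2 / eps * (C * expR ((2 * al + eps) * t)).
  move=> t0.
  apply: (@le_trans _ _ (k * flow_energy a b t + 2 / eps * flow_energy c d t)).
    rewrite /dphi /flow_energy !mulr_sumr -big_split/=; apply: ler_sum => i _.
    rewrite Aa Ab !(mulmxDr, mulmxN, =^~ scalemxAr).
    move: (expm _ *m a) (expm _ *m b) (expm _ *m c) (expm _ *m d) => F G U V.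
    rewrite !mxE.
    set f := F i 0; set g := G i 0; set u := U i 0; set v := V i 0.
    (* AM-GM: [2 f u <= eps / 2 * f ^ 2 + 2 / eps * u ^ 2] *)
    rewrite -subr_ge0.
    have -> : k * (f ^+ 2 + g ^+ 2) + 2 / eps * (u ^+ 2 + v ^+ 2) -
        2 * (f * (al * f - be * g + u) + g * (be * f + al * g + v)) =
        (2 * eps)^-1 * ((eps * f - 2 * u) ^+ 2 + (eps * g - 2 * v) ^+ 2).
      by rewrite /k; field.
    by rewrite mulr_ge0 ?addr_ge0 ?sqr_ge0// invr_ge0 mulr_ge0// ltW.
  by rewrite lerD2l ler_wpM2l ?divr_ge0 ?(ltW e0)// cdC// ltW.
(* Gronwall with integrating factor [expR (- k * t)]; the subtracted term is a primitive of the
   forcing, so [psi] is nonincreasing. *)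
pose psi t := expR (- k * t) * flow_energy a b t - K * expR (eps / 2 * t).
pose dpsi t := expR (- k * t) * dphi t + flow_energy a b t *
  (- k * expR (- k * t)) - K * (eps / 2 * expR (eps / 2 * t)).
have psi_d t : is_derive t (1 : R) psi (dpsi t).
  have d1 := is_derive_expRM (- k) t.
  have d2 := is_derive_expRM (eps / 2) t.
  have d3 := is_derive_flow_energy a b t.
  exact: is_deriveB (is_deriveM d1 d3) (is_deriveZ K d2).
have dpsi_le0 t : 0 < t -> dpsi t <= 0.
  move=> t0; have := dphi_le t t0.
  rewrite -(ler_pM2l (expR_gt0 (- k * t))) mulrDr.
  have -> : expR (- k * t) * (2 / eps * (C * expR ((2 * al + eps) * t))) =
      K * (eps / 2 * expR (eps / 2 * t)).
    have -> : eps / 2 * t = - k * t + (2 * al + eps) * t by rewrite /k; field.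
    by rewrite expRD /K; field.
  by rewrite /dpsi; lra.
(* The sign of [C], hence of [K], is unknown, which explains the absolute value. *)
exists (flow_energy a b 0 + `|K|) => t t0.
have := le_at0_of_derive_le0 psi_d dpsi_le0 t0.
rewrite /psi !mulr0 expR0 mul1r mulr1 => H.
have {}H : expR (- k * t) * flow_energy a b t <=
    (flow_energy a b 0 + `|K|) * expR (eps / 2 * t).
  have E1 : 1 <= expR (eps / 2 * t).
    by rewrite -expR0 ler_expR mulr_ge0// divr_ge0// ltW.
  have K1 := ler_norm K.
  have p0 : 0 <= flow_energy a b 0.
    by rewrite sumr_ge0// => i _; rewrite addr_ge0 ?sqr_ge0.
  have := ler_wpM2l p0 E1.
  have E0 : 0 <= expR (eps / 2 * t) - 1 by rewrite subr_ge0.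
  have := ler_wpM2r E0 K1; have := normr_ge0 K.
  by lra.
have -> : (2 * al + eps) * t = k * t + eps / 2 * t by rewrite /k; field.
rewrite expRD mulrCA -(ler_pM2l (expR_gt0 (- k * t))) [leRHS]mulrA.
by rewrite -expRD mulNr addNr expR0 mul1r -mulNr.
Qed.

End Growth.

(** * Real and imaginary parts, and decay on generalized eigenspaces *)

Section ReIm.
Variables (R : realType) (m : nat).
Implicit Types (A : 'M[R]_m) (u : 'cV[R[i]]_m).

Lemma complexReD : {morph @complex.Re R : x y / x + y >-> x + y}.
Proof. by case=> a b [c d]. Qed.

Lemma complexImD : {morph @complex.Im R : x y / x + y >-> x + y}.
Proof. by case=> a b [c d]. Qed.

Lemma Re_mulmxC A u :
  map_mx (@complex.Re R) (mxC A *m u) = A *m map_mx (@complex.Re R) u.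
Proof.
apply/colP => k; rewrite !mxE (big_morph _ complexReD (erefl _)).
apply: eq_bigr => j _; rewrite !mxE; case: (u j 0) => a b /=.
by rewrite mul0r subr0.
Qed.

Lemma Im_mulmxC A u :
  map_mx (@complex.Im R) (mxC A *m u) = A *m map_mx (@complex.Im R) u.
Proof.
apply/colP => k; rewrite !mxE (big_morph _ complexImD (erefl _)).
apply: eq_bigr => j _; rewrite !mxE; case: (u j 0) => a b /=.
by rewrite mul0r addr0.
Qed.

Lemma Re_mulmxCX A n u :
  map_mx (@complex.Re R) (mxC A ^+ n *m u) = A ^+ n *m map_mx (@complex.Re R) u.
Proof.
elim: n u => [|n IH] u; first by rewrite !expr0 !mul1mx.
by rewrite !exprSr -!mulmxA IH Re_mulmxC.
Qed.

Lemma mxC_sub_scalar A (s : R) : mxC (A - s%:M) = mxC A - s%:C%:M.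
Proof. by rewrite /mxC map_mxB map_scalar_mx. Qed.

(** Induction on [n]: [(A - mu) u] is killed by one power less and is the forcing term for [u]. At
    [n = 0] the vector is zero. *)
Lemma GEC_flow_energy A (mu : R[i]) n u (eps : R) : 0 < eps ->
  (mxC A - mu%:M) ^+ n *m u = 0 ->
  exists C : R, forall t, 0 <= t ->
    flow_energy A (map_mx (@complex.Re R) u) (map_mx (@complex.Im R) u) t <=
    C * expR ((2 * complex.Re mu + eps) * t).
Proof.
move=> e0; elim: n u => [|n IH] u.
  rewrite expr0 mul1mx => ->; exists 0 => t _.
  rewrite mul0r (_ : map_mx _ _ = 0); last by apply/colP => k; rewrite !mxE.
  rewrite (_ : map_mx _ _ = 0); last by apply/colP => k; rewrite !mxE.
  by rewrite /flow_energy big1// => k _; rewrite mulmx0 mxE expr0n addr0.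
rewrite exprSr -mulmxA => /IH[C HC].
set w := (mxC A - mu%:M) *m u in HC.
have Au : mxC A *m u = mu *: u + w.
  by rewrite /w mulmxBl mul_scalar_mx addrC subrK.
move: w Au HC => w Au HC.
apply: (flow_energy_growth_step (be := complex.Im mu) e0 _ _ HC).
- rewrite -Re_mulmxC Au; apply/colP => k; rewrite !mxE.
  by move: (w k 0) (u k 0) (mu) => [c d] [a b] [x y].
- rewrite -Im_mulmxC Au; apply/colP => k; rewrite !mxE.
  move: (w k 0) (u k 0) (mu) => [c d] [a b] [x y] /=.
  by rewrite [x * b + _]addrC.
Qed.

(** Unlike the quadratic energy bound, this entrywise bound passes to linear combinations by the
    triangle inequality alone. *)
Definition flow_bounded A (r : R) : set 'cV[R]_m :=
  [set z | exists C : R, forall t, 0 <= t ->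
    forall k, `|(expm (t *: A) *m z) k 0| <= C * expR (r * t)].

Lemma flow_bounded0 A r : flow_bounded A r 0.
Proof. by exists 0 => t _ k; rewrite mulmx0 mxE normr0 mul0r. Qed.

Lemma flow_boundedD A r z1 z2 :
  flow_bounded A r z1 -> flow_bounded A r z2 -> flow_bounded A r (z1 + z2).
Proof.
move=> [C1 H1] [C2 H2]; exists (C1 + C2) => t t0 k.
rewrite mulmxDr mxE (le_trans (ler_normD _ _))// mulrDl.
by rewrite lerD ?H1 ?H2.
Qed.

Lemma flow_boundedZ A r c z : flow_bounded A r z -> flow_bounded A r (c *: z).
Proof.
move=> [C H]; exists (`|c| * C) => t t0 k.
by rewrite -scalemxAr mxE normrM -mulrA ler_wpM2l ?H.
Qed.

Lemma flow_bounded_sum A r (I : eqType) (rI : seq I) (z : I -> 'cV[R]_m) :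
  (forall i, i \in rI -> flow_bounded A r (z i)) ->
  flow_bounded A r (\sum_(i <- rI) z i).
Proof.
move=> H; rewrite big_seq; apply: (big_ind (flow_bounded A r)) => //.
- exact: flow_bounded0.
- exact: flow_boundedD.
Qed.

Lemma GE_re_im_flow_bounded A (mu : R[i]) (r : R) z : complex.Re mu < r ->
  GE_re_im A mu z -> flow_bounded A r z.
Proof.
move=> mur [u [n _ un0] zE].
(* Taking this gap as [eps] turns the energy rate [2 Re mu + eps] into exactly [2 r]. *)
have e0 : 0 < 2 * (r - complex.Re mu) by rewrite mulr_gt0// subr_gt0.
have [C HC] := GEC_flow_energy e0 un0.
exists (Num.sqrt C) => t t0 k; have := HC t t0.
have -> : (2 * complex.Re mu + 2 * (r - complex.Re mu)) * t = r * t + r * t.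
  by ring.
rewrite expRD -expr2 => H.
(* Splitting the square root needs [0 <= C], which holds because [C] times an exponential bounds a
   nonnegative energy. *)
rewrite -[X in _ * X]ger0_norm ?expR_ge0// -!sqrtr_sqr -sqrtrM; last first.
  rewrite -(pmulr_lge0 _ (expR_gt0 (r * t + r * t))) expRD -expr2.
  by rewrite (le_trans _ H)// sumr_ge0// => i _; rewrite addr_ge0 ?sqr_ge0.
rewrite ler_wsqrtr// (le_trans _ H)//.
rewrite /flow_energy (bigD1 k)//= -addrA.
have ge0 : 0 <= \sum_(i < m | i != k)
    ((expm (t *: A) *m map_mx (@complex.Re R) u) i 0 ^+ 2 +
     (expm (t *: A) *m map_mx (@complex.Im R) u) i 0 ^+ 2).
  by rewrite sumr_ge0// => i _; rewrite addr_ge0 ?sqr_ge0.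
case: zE => ->; rewrite ?lerDl ?addr_ge0 ?sqr_ge0//.
by rewrite addrCA lerDl addr_ge0 ?sqr_ge0.
Qed.

End ReIm.

(** * Generalized eigenspaces *)

Section GeneralizedEigenDecomposition.
Variables (K : fieldType) (n : nat) (B : 'M[K]_n.+1).

Lemma trmxX (M : 'M[K]_n.+1) k : (M ^+ k)^T = M^T ^+ k.
Proof.
by elim: k => [|k IH]; rewrite ?expr0 ?trmx1// exprS exprSr trmx_mul IH.
Qed.

(** Primary decomposition: the powers of distinct linear factors are pairwise coprime, so their
    kernels sum to the kernel of the characteristic polynomial at [B], which is everything by
    Cayley-Hamilton. *)
Lemma geigen_decomposition_row (rs : seq K) (u : 'rV[K]_n.+1) :
  char_poly B = \prod_(a <- rs) ('X - a%:P) ->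
  exists2 w : K -> 'rV[K]_n.+1,
    forall a, w a *m (B - a%:M) ^+ (count_mem a rs) = 0 &
    u = \sum_(a <- undup rs) w a.
Proof.
move=> Brs; set r := undup rs.
pose a_ (i : 'I_(size r)) := tnth (in_tuple r) i.
have a_inj : injective a_ by apply/tuple_uniqP; exact: undup_uniq.
pose p_ i := ('X - (a_ i)%:P) ^+ (count_mem (a_ i) rs).
have Bp : char_poly B = \prod_i p_ i.
  by rewrite Brs -prodr_undup_exp_count big_tnth.
have p_coprime : {in predT &, forall i j, j != i -> coprimep (p_ i) (p_ j)}.
  move=> i j _ _ ij; rewrite coprimep_expr// coprimep_expl//.
  by rewrite coprimep_XsubC root_XsubC (inj_eq a_inj).
have : (u <= \sum_i kermxpoly B (p_ i))%MS.
  rewrite -(kermxpoly_prod _ p_coprime) -Bp.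
  by rewrite /kermxpoly Cayley_Hamilton; apply/sub_kermxP; rewrite mulmx0.
case/sub_sumsmxP => U uE; pose u_ i := U i *m kermxpoly B (p_ i).
(* At most one index [i] satisfies [a_ i = a], and off the roots the sum is empty, so [w] is defined
   on all of [K]. *)
exists (fun a => \sum_(i | a_ i == a) u_ i) => [a|].
  rewrite mulmx_suml big1// => i /eqP <-.
  have -> : (B - (a_ i)%:M) ^+ (count_mem (a_ i) rs) = horner_mx B (p_ i).
    by rewrite rmorphXn rmorphB/= horner_mx_X horner_mx_C.
  by rewrite -mulmxA mulmx_ker mulmx0.
rewrite uE [RHS]big_tnth; apply: eq_bigr => i _.
by rewrite (big_pred1 i)// => j; rewrite /= (inj_eq a_inj).
Qed.

End GeneralizedEigenDecomposition.

(** [kermxpoly] concerns row vectors; columns are reached by transposing, which preserves the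
    characteristic polynomial. *)
Lemma geigen_decomposition (K : fieldType) n (B : 'M[K]_n.+1) (rs : seq K)
    (u : 'cV[K]_n.+1) :
  char_poly B = \prod_(a <- rs) ('X - a%:P) ->
  exists2 w : K -> 'cV[K]_n.+1,
    forall a, (B - a%:M) ^+ (count_mem a rs) *m w a = 0 &
    u = \sum_(a <- undup rs) w a.
Proof.
move=> Brs; have BTrs : char_poly B^T = \prod_(a <- rs) ('X - a%:P).
  rewrite -Brs /char_poly -det_tr; congr (\det _).
  by rewrite /char_poly_mx linearB/= tr_scalar_mx map_trmx trmxK.
have [w wB uE] := geigen_decomposition_row u^T BTrs.
exists (fun a => (w a)^T) => [a|].
  apply: trmx_inj; rewrite trmx_mul trmxK trmx0 trmxX linearB/= tr_scalar_mx.
  exact: wB.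
by rewrite -[LHS]trmxK uE raddf_sum.
Qed.

(** * Frobenius norm and Rayleigh quotient *)

Section MatrixNorms.
Variables (R : realType) (m : nat).
Implicit Types (X Y A : 'M[R]_m).

Lemma sqr_vnorm (x : 'cV[R]_m) : vnorm x ^+ 2 = \sum_k x k 0 ^+ 2.
Proof.
rewrite sqr_sqrtr; first by apply: eq_bigr => k _; rewrite expr2.
by rewrite sumr_ge0// => k _; rewrite -expr2 sqr_ge0.
Qed.

(** Flattening to pairs (column, row) makes the results on [l2norm] available for matrices. *)
Lemma mnormE X : mnorm X = l2norm (fun p : 'I_m * 'I_m => X p.2 p.1).
Proof.
rewrite /mnorm /l2norm -(pair_big xpredT xpredT (fun i k => X k i ^+ 2))/=.
congr Num.sqrt; apply: eq_bigr => i _; rewrite sqr_vnorm.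
by apply: eq_bigr => k _; rewrite mxE.
Qed.

Lemma mnorm_ge0 X : 0 <= mnorm X.
Proof. by rewrite mnormE l2norm_ge0. Qed.

Lemma mnormZ c X : mnorm (c *: X) = `|c| * mnorm X.
Proof.
by rewrite !mnormE -l2normZ; apply: eq_l2norm => p; rewrite mxE.
Qed.

Lemma vnorm_col_le X i : vnorm (col i X) <= mnorm X.
Proof.
rewrite -ler_sqr ?nnegrE ?sqrtr_ge0// [leRHS]sqr_sqrtr; last first.
  by rewrite sumr_ge0// => j _; rewrite sqr_ge0.
by rewrite (bigD1 i)//= lerDl sumr_ge0// => j _; rewrite sqr_ge0.
Qed.

Lemma mnorm_mulmx_le A X : mnorm (A *m X) <= #|{: 'I_m * 'I_m}|%:R *
  (m%:R * (mnorm A * mnorm X)).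
Proof.
rewrite {1}mnormE; apply: l2norm_le_coord => [|[i k]/=].
  by rewrite !mulr_ge0// mnorm_ge0.
rewrite mxE (le_trans (ler_norm_sum _ _ _))// mulr_natl.
have -> : mnorm A * mnorm X *+ m = \sum_(j < m) mnorm A * mnorm X.
  by rewrite sumr_const card_ord.
apply: ler_sum => j _.
rewrite normrM ler_pM// mnormE.
- exact: (@l2norm_coord _ _ (fun p : 'I_m * 'I_m => A p.2 p.1) (j, k)).
- exact: (@l2norm_coord _ _ (fun p : 'I_m * 'I_m => X p.2 p.1) (i, j)).
Qed.

Lemma mnorm_normalize X Y i :
  mnorm Y * vnorm ((mnorm X)^-1 *: col i X - (mnorm Y)^-1 *: col i Y) <=
    2 * mnorm (X - Y).
Proof.
have -> : (mnorm X)^-1 *: col i X - (mnorm Y)^-1 *: col i Y =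
    col i ((mnorm X)^-1 *: X - (mnorm Y)^-1 *: Y).
  by apply/colP => k; rewrite !mxE.
rewrite (le_trans (ler_wpM2l (mnorm_ge0 Y) (vnorm_col_le _ i)))//.
have := l2norm_normalize (fun p : 'I_m * 'I_m => X p.2 p.1)
  (fun p : 'I_m * 'I_m => Y p.2 p.1).
rewrite -!mnormE => /le_trans H; rewrite !(mnormE (_ - _)).
apply: le_trans (H _ _).
  by rewrite (@eq_l2norm _ _ _ (fun p => (mnorm X)^-1 * X p.2 p.1 -
    (mnorm Y)^-1 * Y p.2 p.1))// => p; rewrite !mxE.
have -> // : l2norm (fun p : 'I_m * 'I_m => (X - Y) p.2 p.1) =
  l2norm (fun p : 'I_m * 'I_m => X p.2 p.1 - Y p.2 p.1).
by apply: eq_l2norm => p; rewrite !mxE.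
Qed.

(** The Rayleigh quotient of [X -> A X] for the Frobenius inner product. Its invariance under
    scaling allows [X(t)] to be replaced by [e^{-st} X(t)]. *)
Definition rayleigh A X : R :=
  (mnorm X ^+ 2)^-1 * \sum_i inner (A *m col i X) (col i X).

Lemma rayleighZ A c X : c != 0 -> rayleigh A (c *: X) = rayleigh A X.
Proof.
move=> c0; rewrite /rayleigh mnormZ exprMn real_normK ?num_real// invfM.
have -> : \sum_i inner (A *m col i (c *: X)) (col i (c *: X)) =
    c ^+ 2 * \sum_i inner (A *m col i X) (col i X).
  rewrite mulr_sumr; apply: eq_bigr => i _.
  rewrite /inner mulr_sumr; apply: eq_bigr => k _.
  have -> : col i (c *: X) = c *: col i X by apply/colP => l; rewrite !mxE.
  rewrite -scalemxAr.
  by move: (A *m col i X) (col i X) => z x; rewrite !mxE; ring.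
by rewrite mulrACA mulVf ?mul1r// expf_neq0.
Qed.

Lemma sum_innerE A X : \sum_i inner (A *m col i X) (col i X) =
  \sum_(p : 'I_m * 'I_m) (A *m X) p.2 p.1 * X p.2 p.1.
Proof.
rewrite -(pair_big xpredT xpredT (fun i k => (A *m X) k i * X k i))/=.
apply: eq_bigr => i _; apply: eq_bigr => k _.
by rewrite !colE mulmxA -!colE; move: (A *m X) => Z; rewrite !mxE.
Qed.

(* Also valid for [X = 0], where the junk value of [rayleigh] is 0. *)
Lemma rayleigh_dist A (s : R) X Y : A *m Y = s *: Y ->
  mnorm Y * `|rayleigh A X - s| <=
    (2 * (#|{: 'I_m * 'I_m}|%:R * (m%:R * mnorm (A - s%:M))) + `|s|) *
      mnorm (X - Y).
Proof.
move=> AY; pose N := A - s%:M.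
set K := #|_|%:R * _; have K0 : 0 <= K by rewrite !mulr_ge0// mnorm_ge0.
have NK Z : mnorm (N *m Z) <= K * mnorm Z.
  by rewrite (le_trans (mnorm_mulmx_le _ _))// /K !mulrA.
move: K K0 NK => K K0 NK.
have D0 := mnorm_ge0 (X - Y); have X0 := mnorm_ge0 X.
have YXD : `|mnorm X - mnorm Y| <= mnorm (X - Y).
  rewrite !mnormE (le_trans (l2normB_le _ _))//.
  have -> // : l2norm (fun p : 'I_m * 'I_m => X p.2 p.1 - Y p.2 p.1) =
    l2norm (fun p : 'I_m * 'I_m => (X - Y) p.2 p.1).
  by apply: eq_l2norm => p; rewrite !mxE.
have {YXD} YX : mnorm Y <= mnorm X + mnorm (X - Y).
  by move: YXD; rewrite ler_norml; lra.
(* At [X = 0] the quotient is 0 and the error is [|s|]; this is the source of the summand [|s|] in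
   the constant. *)
have [X_0|X_neq0] := eqVneq (mnorm X) 0.
  rewrite /rayleigh X_0 expr0n invr0 mul0r sub0r normrN mulrC.
  have := ler_wpM2l (normr_ge0 s) YX; rewrite X_0 add0r => /le_trans; apply.
  by rewrite ler_wpM2r// lerDr mulr_ge0.
have X_gt0 : 0 < mnorm X by rewrite lt_neqAle eq_sym X_neq0.
pose T := \sum_(p : 'I_m * 'I_m) (N *m X) p.2 p.1 * X p.2 p.1.
have QT : rayleigh A X - s = T / mnorm X ^+ 2.
  apply/eqP; rewrite -(inj_eq (mulIf (expf_neq0 2 X_neq0))) mulfVK ?expf_neq0//.
  rewrite mulrBl mulrAC mulVf ?expf_neq0// mul1r sum_innerE.
  rewrite mnormE sqr_l2norm mulr_sumr -sumrB; apply/eqP; apply: eq_bigr => p _.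
  rewrite /N mulmxBl mul_scalar_mx [A *m X]lock !mxE -lock; ring.
(* Used with [Z = X] for a uniform bound [K] and, since [N *m Y = 0], with [Z = X - Y] for a small
   one. By [YX] the two together give [2 * K]. *)
have T_le Z : N *m X = N *m Z -> `|T| <= K * mnorm Z * mnorm X.
  rewrite /T => ->; rewrite (le_trans (cauchy_schwarz _ _))//.
  by rewrite -!mnormE ler_wpM2r.
have QZ Z : N *m X = N *m Z -> `|rayleigh A X - s| * mnorm X <= K * mnorm Z.
  move=> /T_le TZ; rewrite QT normrM normfV normrX (ger0_norm X0).
  rewrite -(ler_pM2r X_gt0) -!mulrA -expr2 mulVf ?mulr1 ?expf_neq0//.
  by rewrite mulrA.
have Q1 : `|rayleigh A X - s| <= K by rewrite -(ler_pM2r X_gt0) QZ.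
have Q2 : `|rayleigh A X - s| * mnorm X <= K * mnorm (X - Y).
  apply: QZ; rewrite mulmxBr [N *m Y]mulmxBl AY mul_scalar_mx.
  by rewrite subrr subr0.
have Q3 := ler_wpM2r D0 Q1.
have := ler_wpM2l (normr_ge0 (rayleigh A X - s)) YX.
have := mulr_ge0 (normr_ge0 s) D0.
lra.
Qed.

End MatrixNorms.

(** * Spectral splitting *)

Section SpectralSplitting.
Variables (R : realType) (n : nat) (A : 'M[R]_n.+1).
Local Notation s := (spectral_abscissa A).

Lemma spectrum_seq : exists2 rs : seq R[i],
  char_poly (mxC A) = \prod_(z <- rs) ('X - z%:P) &
  spectrum A = [set` undup rs].
Proof.
have [rs rsE] := closed_field_poly_normal (char_poly (mxC A)).
rewrite (monicP (char_poly_monic _)) scale1r in rsE.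
exists rs => //; apply/seteqP; split => mu; rewrite /spectrum/=.
  by rewrite eigenvalue_root_char rsE root_prod_XsubC mem_undup.
by rewrite mem_undup eigenvalue_root_char rsE root_prod_XsubC.
Qed.

(** Decompose [v] over the complex numbers and take real parts. As [s] is real, [A - s] commutes
    with taking real parts, so the component at [s] lands in [E1]. *)
Lemma E1_E2_decomposition v : spectrum A s%:C ->
  exists y, E1 A y /\ E2 A (v - y).
Proof.
have [rs rsE specE] := spectrum_seq; rewrite specE /= => s_rs.
have [w wB vE] := geigen_decomposition (map_mx (real_complex R) v) rsE.
have Re_v : v = \sum_(a <- undup rs) map_mx (@complex.Re R) (w a).
  apply/colP => k; have /colP/(_ k) := vE; rewrite mxE !summxE.
  move=> /(congr1 (@complex.Re R)) /=.
  rewrite (big_morph _ (@complexReD R) (erefl _)) => ->.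
  by apply: eq_bigr => a _; rewrite mxE.
have wGE a : GEC A a (w a).
  (* The successor ensures an exponent of at least 1 even when [a] is not a root. *)
  exists (count_mem a rs).+1 => //.
  by rewrite exprS -mulmxA wB mulmx0.
exists (map_mx (@complex.Re R) (w s%:C)); split.
  exists (count_mem s%:C rs).+1 => //.
  rewrite -Re_mulmxCX mxC_sub_scalar exprS -mulmxA wB mulmx0.
  by apply/colP => k; rewrite !mxE.
have SE : spectrum A `\ s%:C = [set` rem s%:C (undup rs)].
  rewrite specE; apply/seteqP; split => mu /=.
    by move=> [mu_r /eqP mus]; rewrite mem_rem_uniq ?undup_uniq// inE mus.
  by rewrite mem_rem_uniq ?undup_uniq// inE => /andP[/eqP].
exists (fun mu => map_mx (@complex.Re R) (w mu)).
  by move=> mu _; exists (w mu) => //; left.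
rewrite SE -fsbig_seq ?rem_uniq ?undup_uniq// {1}Re_v (big_rem _ s_rs)/=.
by rewrite [LHS]addrC addKr.
Qed.

(** [Pi1] is a chosen witness, so existence of a splitting yields its defining properties. *)
Lemma Pi1P v : spectrum A s%:C -> E1 A (Pi1 A v) /\ E2 A (v - Pi1 A v).
Proof.
move=> /(E1_E2_decomposition v) vy; rewrite /Pi1 /proj_along.
exact: (xgetPex 0 vy).
Qed.

Lemma E2_flow_bounded (r : R) z :
  (forall mu : R[i], (spectrum A `\ s%:C) mu -> complex.Re mu < r) ->
  E2 A z -> flow_bounded A r z.
Proof.
move=> Sr [w wGE ->]; have [rs _ specE] := spectrum_seq.
have SE : spectrum A `\ s%:C = [set` [seq x <- undup rs | x != s%:C]].
  rewrite specE; apply/seteqP; split => mu /=.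
    by move=> [mu_r /eqP mus]; rewrite mem_filter mus.
  by rewrite mem_filter => /andP[/eqP].
rewrite SE -fsbig_seq ?filter_uniq ?undup_uniq//; apply: flow_bounded_sum.
move=> mu mu_r; have Smu : (spectrum A `\ s%:C) mu by rewrite SE.
exact: GE_re_im_flow_bounded (Sr _ Smu) (wGE _ Smu).
Qed.

(** A real root of the complexified characteristic polynomial is a root of the real one; transposing
    then turns a row eigenvector into a column one. *)
Lemma spectrum_real_eigenvector (r : R) : spectrum A r%:C ->
  exists2 e : 'cV[R]_n.+1, e != 0 & A *m e = r *: e.
Proof.
rewrite /spectrum/= eigenvalue_root_char -map_char_poly fmorph_root => Ar.
have : root (char_poly A^T) r.
  move: Ar; congr (root _ _); rewrite /char_poly -det_tr; congr (\det _).
  by rewrite /char_poly_mx linearB/= tr_scalar_mx map_trmx.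
rewrite -eigenvalue_root_char => /eigenvalueP[x xA x0].
exists x^T; first by rewrite -(inj_eq (@trmx_inj _ _ _)) trmxK trmx0.
by apply: trmx_inj; rewrite trmx_mul trmxK xA linearZ/= trmxK.
Qed.

Lemma eigenvector_not_flow_bounded (r d : R) (e : 'cV[R]_n.+1) : 0 < d ->
  A *m e = r *: e -> flow_bounded A (r - d) e -> e = 0.
Proof.
move=> d0 Ae [C HC]; apply/colP => k; rewrite mxE.
apply/eqP/negPn/negP => ek0.
have ek : 0 < `|e k 0| by rewrite normr_gt0.
have H t : 0 <= t -> `|e k 0| * expR (d * t) <= C.
  move=> t0; have := HC t t0 k.
  rewrite (expm_eigen t Ae) mxE normrM (ger0_norm (expR_ge0 _)) => {}H.
  rewrite -(ler_pM2r (expR_gt0 ((r - d) * t))) -mulrA -expRD.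
  by rewrite -mulrDl addrCA subrr addr0 mulrC.
have C0 : 0 < C.
  by have := H 0 (lexx 0); rewrite mulr0 expR0 mulr1; exact: lt_le_trans.
(* At this time [1 + x <= expR x] gives [|e k 0| + C <= C], a contradiction. *)
have t0 : 0 <= C / `|e k 0| / d by rewrite !divr_ge0// ltW.
have := H _ t0; have := expR_ge1Dx (d * (C / `|e k 0| / d)).
rewrite -(ler_pM2l ek) => /le_trans/[apply].
have -> : `|e k 0| * (1 + d * (C / `|e k 0| / d)) = `|e k 0| + C.
  by field; rewrite !gt_eqF.
by lra.
Qed.

End SpectralSplitting.

(** * Asymptotics of the rescaled flow, and the two estimates *)

Lemma flow_asymptotics (R : realType) n (A : 'M[R]_n.+1) (delta : R)
    (v : 'I_n.+1 -> 'cV[R]_n.+1) :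
  let s := spectral_abscissa A in
  let V := mx_of_cols v in
  let Y := mx_of_cols (fun i => Pi1 A (v i)) in
  spectrum A s%:C -> 0 < delta ->
  (forall mu : R[i], (spectrum A `\ s%:C) mu ->
     complex.Re mu <= s - 2 * delta) ->
  is_basis v -> semisimple A s ->
  [/\ A *m Y = s *: Y, 0 < mnorm Y &
    exists2 C, 0 < C & forall t, 0 <= t ->
      mnorm (expR (- (s * t)) *: (expm (t *: A) *m V) - Y) <=
        C * expR (- (delta * t))].
Proof.
move=> s V Y s_spec d0 specA v_basis ss.
have Y_eig i : A *m Pi1 A (v i) = s *: Pi1 A (v i).
  have [y1 _] := Pi1P (v i) s_spec.
  have : E_ A s (Pi1 A (v i)) by rewrite -ss.
  by rewrite /E_/= mulmxBl mul_scalar_mx => /eqP; rewrite subr_eq0 => /eqP.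
(* The gap [2 * delta] leaves [s - delta] strictly above the other real parts, as the energy
   argument demands. *)
have z_bounded i : flow_bounded A (s - delta) (v i - Pi1 A (v i)).
  have [_ z2] := Pi1P (v i) s_spec.
  by apply: E2_flow_bounded z2 => mu /specA; lra.
have colY i : col i Y = Pi1 A (v i) by apply/colP => k; rewrite !mxE.
have colV i : col i V = v i by apply/colP => k; rewrite !mxE.
have mul_col (B M : 'M[R]_n.+1) k i : (B *m M) k i = (B *m col i M) k 0.
  by rewrite !mxE; apply: eq_bigr => j _; rewrite !mxE.
split.
- apply/matrixP => k i; rewrite mul_col colY Y_eig.
  by rewrite [in RHS]mxE [in LHS]mxE -[in LHS]colY mxE.
- rewrite lt_neqAle mnorm_ge0 andbT eq_sym; apply/eqP => Y0.
  have Pi1_0 i : Pi1 A (v i) = 0.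
    apply/colP => k; rewrite -colY !mxE.
    rewrite mnormE in Y0; have := l2norm_eq0 Y0 (i, k).
    by rewrite mxE.
  have v_bounded i : flow_bounded A (s - delta) (v i).
    by have := z_bounded i; rewrite Pi1_0 subr0.
  have [e e0 Ae] := spectrum_real_eigenvector s_spec.
  suff : e = 0 by move/eqP; rewrite (negbTE e0).
  apply: (eigenvector_not_flow_bounded d0 Ae).
  (* Every vector is a combination of the [v i], hence flow-bounded, including the eigenvector
     [e]. *)
  have := memvf e; rewrite -(span_basis v_basis) => /coord_span ->.
  apply: flow_bounded_sum => j _; apply: flow_boundedZ.
  have : [seq v i | i <- enum 'I_n.+1]`_j \in [seq v i | i <- enum 'I_n.+1].
    by apply: mem_nth; rewrite size_map -cardE; exact: ltn_ord.
  by move=> /mapP[i _ ->].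
have [C CE] := choice z_bounded.
(* The cardinality comes from [l2norm_le_coord]; the [1 +] makes [K] positive. *)
pose K := #|{: 'I_n.+1 * 'I_n.+1}|%:R * (1 + \sum_i `|C i|).
have S0 : 0 <= \sum_i `|C i| by exact: sumr_ge0.
exists K; first by rewrite mulr_gt0 ?ltr_wpDr// ltr0n card_prod !card_ord.
move=> t t0; rewrite mnormE -mulrA.
apply: l2norm_le_coord => [|[i k]/=].
  by rewrite mulr_ge0 ?expR_ge0// addr_ge0.
(* By [Y_eig], [e^{-st} e^{tA}] fixes each [Pi1 A (v i)], so only the [E2] component remains. *)
have -> : (expR (- (s * t)) *: (expm (t *: A) *m V) - Y) k i =
    expR (- (s * t)) * (expm (t *: A) *m (v i - Pi1 A (v i))) k 0.
  rewrite mulmxBr (expm_eigen t (Y_eig i)) -colY -colV.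
  rewrite colE mulmxA -!colE.
  move: (expm _ *m V) => Z; rewrite !mxE mulrBr mulrA -expRD addNr expR0.
  by rewrite mul1r.
rewrite normrM ger0_norm ?expR_ge0//.
rewrite (le_trans (ler_wpM2l (expR_ge0 _) (CE i t t0 k)))//.
have -> : - (delta * t) = - (s * t) + (s - delta) * t by ring.
rewrite expRD [leLHS]mulrCA ler_wpM2r ?mulr_ge0 ?expR_ge0// (bigD1 i)//=.
by rewrite (le_trans (ler_norm _))// addrCA lerDl addr_ge0// sumr_ge0//.
Qed.

Theorem theorem3p4 (R : realType) (m : nat) (A : 'M[R]_m) (delta : R)
    (v : 'I_m -> 'cV[R]_m) :
  let s := spectral_abscissa A in
  let x := fun (i : 'I_m) (t : R) => expm (t *: A) *m v i in
  let X := fun t : R => mx_of_cols (fun i => x i t) in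
  let y := fun i : 'I_m => Pi1 A (v i) in
  let Y := mx_of_cols y in
  let xi := fun i : 'I_m => (mnorm Y)^-1 *: y i in
  perron_like A ->
  0 < delta ->
  (forall mu : R[i], (spectrum A `\ s%:C) mu ->
     complex.Re mu <= s - 2 * delta) ->
  is_basis v ->
  semisimple A s ->
  exists B1 B2 : R,
    [/\ 0 < B1, 0 < B2,
      (forall (i : 'I_m) (t : R), 1 <= t ->
         vnorm ((mnorm (X t))^-1 *: x i t - xi i)
           <= B1 * expR (- (delta * t))) &
      (forall t : R, 1 <= t ->
         `| (mnorm (X t) ^+ 2)^-1 *
              (\sum_(i < m) inner (A *m x i t) (x i t)) - s |
           <= B2 * expR (- (delta * t)))].
Proof.
move=> s x X y Y xi [s_spec _] d0 specA v_basis ss.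
(* For [m = 0] there is no nonzero row vector, so [s] could not be an eigenvalue. *)
case: m => [|n] in A v s x X y Y xi s_spec specA v_basis ss *.
  have /eigenvalueP[u _] := s_spec.
  by rewrite (thinmx0 u) eqxx.
have [AY Y0 [C C0 HC]] := flow_asymptotics s_spec d0 specA v_basis ss.
rewrite -/s -/Y in AY Y0 HC.
pose K := 2 * (#|{: 'I_n.+1 * 'I_n.+1}|%:R *
  (n.+1%:R * mnorm (A - s%:M))) + `|s|.
have K0 : 0 <= K by rewrite addr_ge0// !mulr_ge0// mnorm_ge0.
have XE t : X t = expm (t *: A) *m mx_of_cols v.
  apply/matrixP => k i; rewrite !mxE; apply: eq_bigr => j _.
  by rewrite !mxE.
have colX t i : col i (X t) = x i t by apply/colP => k; rewrite !mxE.
have colY i : col i Y = y i by apply/colP => k; rewrite !mxE.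
have HX t : 1 <= t ->
    mnorm (expR (- (s * t)) *: X t - Y) <= C * expR (- (delta * t)).
  by move=> t1; rewrite XE HC// (le_trans _ t1).
(* The 2 comes from [mnorm_normalize], and [K] from [rayleigh_dist]; [K + 1] is positive even if [K]
   vanishes. *)
exists (2 * C / mnorm Y), ((K + 1) * C / mnorm Y); split.
- by rewrite !mulr_gt0 ?invr_gt0.
- by rewrite !mulr_gt0 ?invr_gt0// ltr_wpDl.
- move=> i t t1; rewrite -(ler_pM2l Y0).
  have c0 := expR_gt0 (- (s * t)).
  have := mnorm_normalize (expR (- (s * t)) *: X t) Y i.
  have -> : col i (expR (- (s * t)) *: X t) = expR (- (s * t)) *: x i t.
    by rewrite -colX; apply/colP => k; rewrite !mxE.
  rewrite mnormZ gtr0_norm// scalerA invfM mulrAC mulVf ?gt_eqF// mul1r colY.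
  move=> /le_trans; apply.
  have -> : mnorm Y * (2 * C / mnorm Y * expR (- (delta * t))) =
      2 * (C * expR (- (delta * t))) by field; rewrite gt_eqF.
  by rewrite ler_wpM2l// HX.
- move=> t t1; rewrite -(ler_pM2l Y0).
  have c0 := expR_gt0 (- (s * t)).
  have := rayleigh_dist (expR (- (s * t)) *: X t) AY.
  rewrite rayleighZ ?gt_eqF// /rayleigh.
  under eq_bigr do rewrite colX.
  move=> /le_trans; apply.
  have -> : mnorm Y * ((K + 1) * C / mnorm Y * expR (- (delta * t))) =
      (K + 1) * (C * expR (- (delta * t))) by field; rewrite gt_eqF.
  by rewrite ler_pM ?mnorm_ge0 ?HX// lerDl.
Qed.
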